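(* Let $G_1,G_2$ be finite connected simple graphs, $x_1\in V(G_1)$, $x_2\in V(G_2)$, and let $G_1[x_1]\oplus G_2[x_2]$ be their $1$-sum. Then \[\lambda_{\max}\bigl(G_1[x_1]\oplus G_2[x_2]\bigr)\leq\max\{\lambda_{\max}(G_1),\lambda_{\max}(G_2)\}.\]
   Context: The $1$-sum $G_1[x_1]\oplus G_2[x_2]$ is obtained from the disjoint union of $G_1$ and $G_2$ by identifying $x_1$ and $x_2$ into a single new vertex. $\lambda_{\max}(H)$ denotes the largest eigenvalue of the normalized Laplacian $L=\mathrm{Id}-D^{-1}A$ of a graph $H$. *)

(* Defs.v *)
From mathcomp Require Import all_boot all_order all_algebra.
From mathcomp Require Import boolp classical_sets reals.

Set Implicit Arguments.
Unset Strict Implicit.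
Unset Printing Implicit Defensive.

Import Order.TTheory GRing.Theory Num.Theory.

Local Open Scope ring_scope.

Record graph := Graph {
  vertex :> finType;
  adj : rel vertex;
  adj_sym : symmetric adj;
  adj_irr : irreflexive adj }.

Definition connected_graph (G : graph) : Prop :=
  forall x y : G, connect (@adj G) x y.

Definition deg (G : graph) (x : G) : nat := #|[set y | adj x y]|.

Section DisjointUnion.
Variables G1 G2 : graph.

Definition dunion_adj (u v : G1 + G2) : bool :=
  match u, v with
  | inl a, inl b => adj a b
  | inr a, inr b => adj a b
  | _, _ => false
  end.

Lemma dunion_sym : symmetric dunion_adj.
Proof. by case=> a [] b //=; rewrite adj_sym. Qed.

Lemma dunion_irr : irreflexive dunion_adj.
Proof. by case=> a /=; rewrite adj_irr. Qed.

Definition dunion : graph := Graph dunion_sym dunion_irr.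

End DisjointUnion.

Section OneSum.
Variables (G1 G2 : graph) (x1 : G1) (x2 : G2).

(* [None] is the new vertex; [Some u] is a vertex u of the disjoint union
   other than x1 and x2. *)
Definition one_sum_vertex : finType :=
  option {u : dunion G1 G2 | (u != inl x1) && (u != inr x2)}.

(* The identification map: [insub] sends x1 and x2 to [None]. *)
Definition one_sum_proj (u : dunion G1 G2) : one_sum_vertex := insub u.

Definition one_sum_adj (p q : one_sum_vertex) : bool :=
  [exists u, exists v,
     [&& adj u v, one_sum_proj u == p & one_sum_proj v == q]].

Lemma one_sum_sym : symmetric one_sum_adj.
Proof.
have H p q : one_sum_adj p q -> one_sum_adj q p.
  case/existsP=> u /existsP[v /and3P[uv pu qv]].
  by apply/existsP; exists v; apply/existsP; exists u; rewrite adj_sym uv qv.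
by move=> p q; apply/idP/idP; apply: H.
Qed.

Lemma one_sum_irr : irreflexive one_sum_adj.
Proof.
move=> p; apply/negbTE/negP=> /existsP[u /existsP[v /and3P[uv /eqP pu /eqP pv]]].
move: pv; rewrite -pu /one_sum_proj.
case: insubP => [w _ wv|]; case: insubP => [z _ zu|] //.
  by move=> [wz]; move: uv; rewrite -wv -zu wz adj_irr.
rewrite !negb_and !negbK => /orP[] /eqP u_ /orP[] /eqP v_ _;
  by move: uv; rewrite u_ v_ /= ?adj_irr.
Qed.

Definition one_sum : graph := Graph one_sum_sym one_sum_irr.

End OneSum.

Section Laplacian.
Variables (R : realType) (G : graph).

Definition adjacency_mx : 'M[R]_#|G| :=
  \matrix_(i, j) (adj (enum_val i) (enum_val j))%:R.

(* D^-1.  As 0^-1 = 0, an isolated vertex has a zero row here; for a connected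
   graph this concerns only the one-vertex graph, whose Laplacian is then Id. *)
Definition inv_degree_mx : 'M[R]_#|G| :=
  diag_mx (\row_i (deg (enum_val i))%:R^-1).

Definition normalized_laplacian : 'M[R]_#|G| :=
  1%:M - inv_degree_mx *m adjacency_mx.

(* [eigenvalue] is about row eigenvectors, which gives the same spectrum as
   column ones; it is real, D^(1/2) L D^(-1/2) being symmetric when D is
   invertible.  The supremum is a maximum as soon as G has
   a vertex: see [lambda_max_eigenvalue] and [lambda_max_ub]. *)
Definition lambda_max : R :=
  sup [set a | eigenvalue normalized_laplacian a]%classic.

Lemma eigenvalue_finite : exists s : seq R,
  forall a, eigenvalue normalized_laplacian a = (a \in s).
Proof.
have rts (n : nat) (q : {poly R}) : (size q < n)%N -> q != 0 ->
    exists s : seq R, forall a, root q a = (a \in s).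
  elim: n q => // n IH q szq q0.
  have [[a ra]|nr] := pselect (exists a, root q a); last first.
    by exists [::] => a; apply/negP=> ra; apply: nr; exists a.
  case/factor_theorem: ra => q' defq.
  have q'0 : q' != 0 by apply: contraNneq q0 => q'0; rewrite defq q'0 mul0r.
  case: (IH q' _ q'0) => [|s Hs].
    by move: szq; rewrite defq size_Mmonic ?monicXsubC // size_XsubC addn2.
  by exists (a :: s) => b; rewrite defq rootM root_XsubC Hs inE orbC.
have [s Hs] := rts _ _ (ltnSn _) (monic_neq0 (char_poly_monic normalized_laplacian)).
by exists s => a; rewrite eigenvalue_root_char.
Qed.

Lemma lambda_max_ub (a : R) :
  eigenvalue normalized_laplacian a -> a <= lambda_max.
Proof.
move=> ea; apply: ub_le_sup => //; have [s Hs] := eigenvalue_finite.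
exists (\sum_(b <- s) `|b|) => b /=; rewrite Hs => bs.
apply: le_trans (ler_norm b) _.
by rewrite (big_rem b) //= lerDl sumr_ge0.
Qed.

Lemma eigenvalue_exists : (0 < #|G|)%N ->
  exists a, eigenvalue normalized_laplacian a.
Proof.
move=> G0; have row_nz i (v : 'rV[R]_#|G|) : v 0 i != 0 -> v != 0.
  by apply: contraNneq => ->; rewrite mxE.
have [[i di]|nd] := pselect (exists i : 'I_#|G|, deg (enum_val i : G) = 0%N).
  exists 1; apply/eigenvalueP; exists (delta_mx 0 i); last first.
    by apply: (row_nz i); rewrite mxE !eqxx oner_eq0.
  rewrite mulmxBr mulmx1 mulmxA scale1r -rowE.
  rewrite (_ : row i _ = 0) ?mul0mx ?subr0 //.
  by apply/rowP=> j; rewrite !mxE di invr0 mul0rn.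
have d0 (i : 'I_#|G|) : (deg (enum_val i : G))%:R != 0 :> R.
  by rewrite pnatr_eq0; apply/eqP=> di; apply: nd; exists i.
exists 0; apply/eigenvalueP; exists (\row_(i < #|G|) (deg (enum_val i : G))%:R); last first.
  by apply: (row_nz (Ordinal G0)); rewrite mxE.
rewrite scale0r mulmxBr mulmx1 mulmxA; apply/eqP; rewrite subr_eq0; apply/eqP.
apply/rowP=> j; rewrite mul_mx_diag !mxE.
under eq_bigr => i _ do rewrite !mxE mulfV // mul1r.
rewrite -natr_sum; congr _%:R; rewrite /deg -sum1_card big_mkcond /=.
rewrite [LHS](reindex (@enum_val G predT)) /=; last first.
  by apply: onW_bij; apply: enum_val_bij.
by apply: eq_bigr => i _; rewrite inE adj_sym; case: (adj _ _).
Qed.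

Lemma lambda_max_eigenvalue : (0 < #|G|)%N ->
  eigenvalue normalized_laplacian lambda_max.
Proof.
move=> G0; have [a0 ea0] := eigenvalue_exists G0.
have [s Hs] := eigenvalue_finite.
have s0 : a0 \in s by rewrite -Hs.
pose m := \big[Num.max/a0]_(b <- s) b.
have ms : m \in s.
  rewrite /m big_seq; elim/big_ind: _ => // x y xs ys.
  by rewrite /Num.max; case: ifP.
suff -> : lambda_max = m by rewrite Hs.
apply/eqP; rewrite eq_le lambda_max_ub ?Hs // andbT.
apply: ge_sup; first by exists a0.
by move=> b /=; rewrite Hs => bs; rewrite /m; apply: le_bigmax_seq bs _.
Qed.

End Laplacian.

Arguments one_sum : clear implicits.
Arguments lambda_max : clear implicits.

(* Main.v *)
(* A top eigenfunction f of the 1-sum realizes the Rayleigh quotient energy/weight.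
   As the edges of the 1-sum are those of G1 together with those of G2, and
   degrees add up at the glued vertex, numerator and denominator are the sums of
   the ones for the restrictions of f to G1 and G2; these are bounded by the
   Rayleigh principle, which comes from the spectral theorem over R[i].  If the
   weight of f vanishes, f lives on isolated vertices and the eigenvalue is 1,
   which is also an eigenvalue of a graph having an isolated vertex. *)
Require Import Defs.
From mathcomp Require Import all_boot all_order all_algebra.
From mathcomp Require Import classical_sets reals.
From mathcomp Require Import complex ring.

Set Implicit Arguments.
Unset Strict Implicit.

Import Order.TTheory GRing.Theory Num.Theory.
Local Open Scope ring_scope.

(** * Rayleigh principle for real symmetric matrices *)

(** Over R[i] the matrix is Hermitian, hence unitarily diagonalizable with real eigenvalues. In an
    orthonormal eigenbasis the quadratic form is a sum of squared moduli weighted by eigenvalues,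
    each at most [m]. *)
Lemma symmetric_rayleigh_le (R : rcfType) (n : nat) (S : 'M[R]_n) (m : R) :
  S^T = S -> (forall a, eigenvalue S a -> a <= m) ->
  forall v : 'rV_n, (v *m S *m v^T) 0 0 <= m * (v *m v^T) 0 0.
Proof.
move=> symS le_m v; pose c : {rmorphism R -> complex R} := real_complex R.
have creal x : c x \is Num.real by rewrite complex_real.
pose A := map_mx c S; pose w := map_mx c v.
have realA : A \is a realmx by apply/mxOverP=> i j; rewrite mxE.
have symA : A \is symmetricmx.
  by apply/is_hermitianmxP; rewrite expr0 scale1r map_mx_id // /A map_trmx symS.
have hermA := realsym_hermsym symA realA.
have defA := orthomx_spectralP (hermitian_normalmx hermA).
set P := spectralmx A in defA; set d := spectral_diag A in defA.
have PU : P \is unitarymx := spectral_unitarymx A.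
have Pu : P \in unitmx := spectral_unit A.
have le_d i : d 0 i <= c m.
  have /mxOverP/(_ 0 i)/complex_realP[k dk] :=
    hermitian_spectral_diag_real hermA.
  rewrite -/d in dk; rewrite dk lecR; apply: le_m.
  suff: eigenvalue A (d 0 i) by rewrite dk eigenvalue_map.
  apply/eigenvalueP.
  (* As [A] is P^-1 diag(d) P, the rows of [P] are row eigenvectors of [A]. *)
  exists (row i P); last first.
    apply/eqP=> Pi0; have := mulmxV Pu => /(congr1 (row i)).
    rewrite row_mul Pi0 mul0mx => /rowP/(_ i); rewrite !mxE eqxx.
    by move/eqP; rewrite eq_sym oner_eq0.
  rewrite defA -row_mul !mulmxA mulmxV // mul1mx row_mul row_diag_mx.
  by rewrite -scalemxAl -rowE.
have wR : map_mx Num.conj w = w.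
  by apply: realmxC; apply/mxOverP=> i j; rewrite mxE.
(* The coordinates of [w] in the orthonormal basis formed by the rows of [P]. *)
pose y := w *m map_mx Num.conj P^T.
have yT : map_mx Num.conj y^T = P *m w^T.
  rewrite /y trmx_mul map_mxM -[in RHS]wR; congr (_ *m _).
    by apply/matrixP=> i j; rewrite !mxE; exact: conjCK.
  by apply/matrixP=> i j; rewrite !mxE.
have qS : c ((v *m S *m v^T) 0 0) = \sum_i d 0 i * `|y 0 i| ^+ 2.
  have -> : c ((v *m S *m v^T) 0 0) = (w *m A *m w^T) 0 0.
    transitivity (map_mx c (v *m S *m v^T) 0 0); first by rewrite [RHS]mxE.
    by rewrite !map_mxM /= map_trmx.
  rewrite defA invmx_unitary // !mulmxA -/y -mulmxA -yT.
  rewrite mxE; apply: eq_bigr => i _.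
  by rewrite mul_mx_diag !mxE normCK mulrAC mulrA mulrC mulrA.
have q1 : c ((v *m v^T) 0 0) = \sum_i `|y 0 i| ^+ 2.
  have -> : c ((v *m v^T) 0 0) = (w *m w^T) 0 0.
    transitivity (map_mx c (v *m v^T) 0 0); first by rewrite [RHS]mxE.
    by rewrite map_mxM /= map_trmx.
  have -> : w *m w^T = y *m map_mx Num.conj y^T.
    by rewrite yT mulmxA /y mulmxKtV.
  by rewrite mxE; apply: eq_bigr => i _; rewrite !mxE normCK.
rewrite -lecR rmorphM /= -/c -/(c _) qS [X in _ <= _ * X]q1 mulr_sumr.
by apply: ler_sum => i _; rewrite ler_wpM2r // exprn_ge0.
Qed.

(** * Sums over ordered edges *)

(** Each edge counts once in each direction, so [F] need not be symmetric. *)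
Definition edge_sum (V : nmodType) (G : graph) (F : G -> G -> V) : V :=
  \sum_u \sum_(v | adj u v) F u v.
Arguments edge_sum {V} G F.

Lemma edge_sum_const (R : pzSemiRingType) (G : graph) (f : G -> R) :
  edge_sum G (fun u _ => f u) = \sum_u (deg u)%:R * f u.
Proof.
apply: eq_bigr => u _; rewrite sumr_const mulr_natl; congr (_ *+ _).
by apply: eq_card => v; rewrite inE.
Qed.

Lemma edge_sum_adj (R : pzSemiRingType) (G : graph) (F : G -> G -> R) :
  edge_sum G F = \sum_u \sum_v (adj u v)%:R * F u v.
Proof.
apply: eq_bigr => u _; rewrite big_mkcond; apply: eq_bigr => v _.
by case: (adj u v); rewrite ?mul1r ?mul0r.
Qed.

Lemma deg0_adj (G : graph) (u v : G) : deg u = 0%N -> adj u v = false.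
Proof. by move/eqP; rewrite cards_eq0 => /eqP/setP/(_ v); rewrite !inE. Qed.

Lemma edge_sum_dunion (V : nmodType) (G1 G2 : graph)
    (F : dunion G1 G2 -> dunion G1 G2 -> V) :
  edge_sum (dunion G1 G2) F =
    edge_sum G1 (fun u v => F (inl u) (inl v)) +
    edge_sum G2 (fun u v => F (inr u) (inr v)).
Proof.
rewrite /edge_sum big_sumType /=; congr (_ + _); apply: eq_bigr => u _;
  by rewrite big_sumType /= big_pred0_eq ?addr0 ?add0r.
Qed.

(** * Edges of the 1-sum *)

Section OneSumEdges.
Variables (G1 G2 : graph) (x1 : G1) (x2 : G2).
Let proj := @one_sum_proj G1 G2 x1 x2.

Lemma one_sum_proj_eq u v : proj u = proj v ->
  u = v \/ u \in [:: inl x1; inr x2] /\ v \in [:: inl x1; inr x2].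
Proof.
rewrite /proj /one_sum_proj.
case: insubP => [a _ au|]; case: insubP => [b _ bv|] //.
  by move=> [ab]; left; rewrite -au -bv ab.
by rewrite !negb_and !negbK !inE; right.
Qed.

Lemma one_sum_proj_surj p : exists u, proj u = p.
Proof.
case: p => [a|]; first by exists (val a); rewrite /proj /one_sum_proj valK.
by exists (inl x1); rewrite /proj /one_sum_proj insubN ?eqxx.
Qed.

(** An edge of the disjoint union stays inside one component. So a common endpoint leaves no choice
    between [x1] and [x2] for the other one, and no edge has both ends among [x1] and [x2]. *)
Lemma one_sum_proj_edge_inj u v u' v' :
  adj u v -> adj u' v' -> proj u = proj u' -> proj v = proj v' ->
  u = u' /\ v = v'.
Proof.
move=> uv uv' /one_sum_proj_eq pu /one_sum_proj_eq pv.
case: pu => [uu|[]]; case: pv => [vv|[]] //; rewrite !inE.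
- by move=> /orP[]/eqP vE /orP[]/eqP vE'; subst; move: uv uv'; case: u' => a.
- by move=> /orP[]/eqP vE /orP[]/eqP vE'; subst; move: uv uv'; case: v' => a.
- by move=> /orP[]/eqP vE /orP[]/eqP vE' /orP[]/eqP wE /orP[]/eqP wE'; subst;
    move: uv uv'; rewrite /= ?adj_irr.
Qed.

(** The identification map is a bijection on ordered edges. This makes energy and weight additive,
    with no separate computation of degrees at the glued vertex. *)
Lemma edge_sum_one_sum (V : nmodType)
    (F : one_sum G1 G2 x1 x2 -> one_sum G1 G2 x1 x2 -> V) :
  edge_sum (one_sum G1 G2 x1 x2) F =
    edge_sum G1 (fun u v => F (proj (inl u)) (proj (inl v))) +
    edge_sum G2 (fun u v => F (proj (inr u)) (proj (inr v))).
Proof.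
rewrite -(edge_sum_dunion (fun u v => F (proj u) (proj v))) /edge_sum.
rewrite !pair_big_dep /=.
pose E := [set e : dunion G1 G2 * dunion G1 G2 | adj e.1 e.2].
pose h (e : dunion G1 G2 * dunion G1 G2) := (proj e.1, proj e.2).
have h_inj : {in E &, injective h}.
  move=> [u v] [u' v']; rewrite !inE /= => uv uv' [pu pv].
  by have [-> ->] := one_sum_proj_edge_inj uv uv' pu pv.
transitivity (\sum_(e in h @: E) F e.1 e.2).
  apply: eq_bigl => -[p q]; apply/existsP/imsetP.
    case=> u /existsP[v /and3P[uv /eqP pu /eqP pv]].
    by exists (u, v); rewrite ?inE // /h /proj pu pv.
  case=> -[u v]; rewrite inE /= => uv [-> ->].
  by exists u; apply/existsP; exists v; rewrite uv !eqxx.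
by rewrite big_imset //=; apply: eq_bigl => e; rewrite inE.
Qed.

Lemma one_sum_isolated (p : one_sum G1 G2 x1 x2) :
  deg p = 0%N -> (exists u : G1, deg u = 0%N) \/ (exists u : G2, deg u = 0%N).
Proof.
have [u <-] := one_sum_proj_surj p => pu0.
have noadj v : adj u v = false.
  apply/negP=> uv; suff: @adj (one_sum G1 G2 x1 x2) (proj u) (proj v).
    by rewrite (deg0_adj _ pu0).
  by apply/existsP; exists u; apply/existsP; exists v; rewrite uv !eqxx.
case: u noadj {pu0} => u noadj; [left|right]; exists u; apply: eq_card0 => v.
  by rewrite inE; apply: (noadj (inl v)).
by rewrite inE; apply: (noadj (inr v)).
Qed.

End OneSumEdges.

(** * Rayleigh quotients of the normalized Laplacian *)

Section Rayleigh.
Variables (R : realType) (G : graph).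

Lemma sum_enum_val (V : nmodType) (F : G -> V) :
  \sum_(i < #|G|) F (enum_val i) = \sum_u F u.
Proof.
rewrite [RHS](reindex (@enum_val G predT)) //.
by apply: onW_bij; apply: enum_val_bij.
Qed.

Lemma normalized_laplacianE i j : normalized_laplacian R G i j =
  (i == j)%:R - (deg (enum_val i))%:R^-1 * (adj (enum_val i) (enum_val j))%:R.
Proof. by rewrite /normalized_laplacian mul_diag_mx !mxE. Qed.

(** The row of the Laplacian at an isolated vertex is a unit vector, which is thus an eigenvector
    for 1. *)
Lemma lambda_max_ge1 (u : G) : deg u = 0%N -> 1 <= lambda_max R G.
Proof.
move=> du; apply: lambda_max_ub; apply/eigenvalueP.
exists (delta_mx 0 (enum_rank u)); last first.
  apply/eqP=> /rowP/(_ (enum_rank u)); rewrite !mxE !eqxx.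
  by apply/eqP; rewrite oner_eq0.
rewrite scale1r -rowE; apply/rowP=> j.
rewrite [LHS]mxE normalized_laplacianE enum_rankK du invr0 mul0r subr0.
by rewrite mxE eqxx eq_sym.
Qed.

(* Summing over ordered edges, [energy f] is the sum over unordered edges of
   (f u - f v)^2, so that [energy f / weight f] is the usual Rayleigh quotient. *)
Definition energy (f : G -> R) : R :=
  edge_sum G (fun u v => f u ^+ 2 - f u * f v).

Definition weight (f : G -> R) : R := edge_sum G (fun u v => f u ^+ 2).

Lemma energyE (f : G -> R) :
  energy f = \sum_u ((deg u)%:R * f u ^+ 2 - \sum_v (adj u v)%:R * (f u * f v)).
Proof.
rewrite sumrB -edge_sum_const -edge_sum_adj /energy /edge_sum -sumrB.
by apply: eq_bigr => u _; rewrite sumrB.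
Qed.

(** This is the Rayleigh principle for Id - D^(-1/2) A D^(-1/2), evaluated at D^(1/2) f. *)
Lemma energy_le (f : G -> R) : energy f <= lambda_max R G * weight f.
Proof.
pose d (i : 'I_#|G|) : R := (deg (enum_val i))%:R.
pose s i := Num.sqrt (d i).
(* With E = diag(e) invertible even when G has isolated vertices, the symmetric
   matrix S below satisfies S = E L E^-1 and so has the eigenvalues of L. *)
pose e i := if d i == 0 then 1 else s i.
pose a (i j : 'I_#|G|) : R := (adj (enum_val i) (enum_val j))%:R.
have d_ge0 i : 0 <= d i by apply: ler0n.
have s2 i : s i * s i = d i by rewrite -expr2 sqr_sqrtr.
have s0 i : (s i == 0) = (d i == 0).
  by rewrite sqrtr_eq0 eq_le d_ge0 andbT.
have e0 i : e i != 0.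
  by rewrite /e; case: ifP => [|/negbT]; rewrite ?oner_eq0 ?s0.
have aC i j : a i j = a j i by rewrite /a adj_sym.
have d0a i j : d i = 0 -> a i j = 0.
  by move/eqP; rewrite pnatr_eq0 => /eqP di; rewrite /a deg0_adj.
pose S : 'M[R]_#|G| :=
  \matrix_(i, j) ((i == j)%:R - (s i)^-1 * a i j * (s j)^-1).
have symS : S^T = S.
  apply/matrixP=> i j; rewrite !mxE eq_sym aC; congr (_ - _).
  by rewrite mulrC [_^-1 * a _ _]mulrC mulrA.
have simS i j : S i j * e j = e i * normalized_laplacian R G i j.
  rewrite normalized_laplacianE mxE mulrBl mulrBr -/(d i) -/(a i j).
  congr (_ - _); first by case: eqP => [->|]; rewrite ?mul0r ?mulr0 ?mul1r ?mulr1.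
  (* At an isolated vertex the adjacency entry vanishes, so the default value of the inverse is
     harmless. *)
  have [di|di] := eqVneq (d i) 0; first by rewrite d0a // !(mul0r, mulr0).
  have [dj|dj] := eqVneq (d j) 0; first by rewrite aC d0a // !(mul0r, mulr0).
  rewrite /e (negbTE di) (negbTE dj) mulfVK ?s0 // mulrA; congr (_ * _).
  by rewrite -s2 invfM mulrA mulfV ?s0 // mul1r.
have le_S b : eigenvalue S b -> b <= lambda_max R G.
  case/eigenvalueP=> w wS w0; apply: lambda_max_ub; apply/eigenvalueP.
  exists (\row_i (w 0 i * e i)); last first.
    apply: contraNneq w0 => /rowP we0; apply/eqP/rowP=> i.
    by have /eqP := we0 i; rewrite !mxE mulf_eq0 (negbTE (e0 i)) orbF => /eqP.
  apply/rowP=> j; rewrite [LHS]mxE.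
  under eq_bigr => i _ do rewrite mxE -mulrA -simS mulrA.
  rewrite -mulr_suml; move/rowP/(_ j): wS; rewrite !mxE => ->.
  by rewrite mulrA.
pose v : 'rV[R]_#|G| := \row_i (s i * f (enum_val i)).
have := symmetric_rayleigh_le symS le_S v.
have -> : (v *m v^T) 0 0 = weight f.
  rewrite mxE /weight edge_sum_const -sum_enum_val; apply: eq_bigr => i _.
  by rewrite !mxE mulrACA s2.
suff -> : (v *m S *m v^T) 0 0 = energy f by [].
rewrite energyE -sum_enum_val -mulmxA mxE.
apply: eq_bigr => i _; rewrite -sum_enum_val.
have -> : (S *m v^T) i 0 = v 0 i - \sum_j (s i)^-1 * a i j * (s j)^-1 * v 0 j.
  rewrite mxE (eq_bigr (fun j => (i == j)%:R * v 0 j -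
    (s i)^-1 * a i j * (s j)^-1 * v 0 j)).
    rewrite sumrB; congr (_ - _); rewrite (bigD1 i) //= eqxx mul1r big1 ?addr0 //.
    by move=> j; rewrite eq_sym => /negbTE->; rewrite mul0r.
  by move=> j _; rewrite [S i j]mxE [v^T j 0]mxE mulrBl.
rewrite mulrBr mulr_sumr; congr (_ - _); first by rewrite mxE mulrACA s2.
apply: eq_bigr => j _; rewrite -/(a i j) !mxE.
have [di|di] := eqVneq (d i) 0; first by rewrite d0a // !(mul0r, mulr0).
have [dj|dj] := eqVneq (d j) 0; first by rewrite aC d0a // !(mul0r, mulr0).
have si : s i != 0 by rewrite s0.
have sj : s j != 0 by rewrite s0.
by field; rewrite si sj.
Qed.

(** A row eigenvector [w] gives the function f = D^-1 w; pairing the eigenvalue equation with [f]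
    gives the energy identity. *)
Lemma eigenvalue_energy (a : R) : eigenvalue (normalized_laplacian R G) a ->
  (exists2 f : G -> R, 0 < weight f & energy f = a * weight f) \/
  (a = 1 /\ exists u : G, deg u = 0%N).
Proof.
case/eigenvalueP=> w wL w0.
pose d (u : G) : R := (deg u)%:R.
pose x (u : G) := w 0 (enum_rank u).
(* Since [0^-1 = 0], [f] vanishes on the isolated vertices. *)
pose f u := (d u)^-1 * x u.
(* This is the entry at [u] of wL = aw, with w D^-1 written as [f]. *)
have eqx u : x u - \sum_v (adj u v)%:R * f v = a * x u.
  have /rowP/(_ (enum_rank u)) := wL; rewrite !mxE -/(x u) => <-.
  rewrite -sum_enum_val [RHS](eq_bigr (fun i => w 0 i * (i == enum_rank u)%:R -
    (adj u (enum_val i))%:R * f (enum_val i))).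
    rewrite sumrB; congr (_ - _); rewrite (bigD1 (enum_rank u)) //= eqxx mulr1.
    by rewrite big1 ?addr0 // => i /negbTE->; rewrite mulr0.
  move=> i _; rewrite normalized_laplacianE mulrBr enum_rankK /f /x enum_valK.
  by rewrite adj_sym; congr (_ - _); rewrite mulrC -mulrA mulrCA.
have dff u : d u * f u ^+ 2 = f u * x u.
  rewrite /f; have [->|du] := eqVneq (d u) 0; first by rewrite invr0 !mul0r.
  by field.
have Ef : energy f = a * weight f.
  rewrite energyE /weight edge_sum_const mulr_sumr.
  apply: eq_bigr => u _; rewrite dff mulrCA -eqx mulrBr mulr_sumr; congr (_ - _).
  by apply: eq_bigr => v _; rewrite mulrCA.
have d2_ge0 u : 0 <= d u * f u ^+ 2 by rewrite mulr_ge0 ?sqr_ge0 // ler0n.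
have : 0 <= weight f.
  by rewrite /weight edge_sum_const; apply: sumr_ge0 => u _; apply: d2_ge0.
rewrite le_eqVlt => /orP[/eqP/esym W0|]; last by left; exists f.
(* A zero weight is a vanishing sum of nonnegative terms, so [f] is zero and [w] lives on isolated
   vertices, where the equation reads x = a x. *)
have f0 u : f u = 0.
  move: W0; rewrite /weight edge_sum_const => /psumr_eq0P W0.
  have /eqP := W0 (fun u _ => d2_ge0 u) u isT; rewrite mulf_eq0 sqrf_eq0.
  by case/orP=> /eqP // du; rewrite /f /d du invr0 mul0r.
have [i wi] : exists i, w 0 i != 0.
  by apply/existsP; apply: contraNT w0 => /existsPn w0; apply/eqP/rowP=> i;
    rewrite mxE; apply/eqP; move: (w0 i); rewrite negbK.
have xi : x (enum_val i) != 0 by rewrite /x enum_valK.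
right; split.
  have := eqx (enum_val i); rewrite big1 => [|v _]; last by rewrite f0 mulr0.
  by rewrite subr0 -{1}[x _]mul1r => /(mulIf xi).
exists (enum_val i); apply/eqP; have /eqP := f0 (enum_val i).
by rewrite mulf_eq0 (negbTE xi) orbF invr_eq0 pnatr_eq0.
Qed.

End Rayleigh.

Unset Implicit Arguments.
Set Strict Implicit.

Theorem theorem5p13 (R : realType) (G1 G2 : graph)
    (hG1 : connected_graph G1) (hG2 : connected_graph G2)
    (x1 : G1) (x2 : G2) :
  lambda_max R (one_sum G1 G2 x1 x2)
    <= Num.max (lambda_max R G1) (lambda_max R G2).
Proof.
have sum_gt0 : (0 < #|one_sum G1 G2 x1 x2|)%N by apply/card_gt0P; exists None.
have [[f W_gt0 Ef]|[-> [p /one_sum_isolated[[u du]|[u du]]]]] :=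
  eigenvalue_energy (lambda_max_eigenvalue R sum_gt0); last first.
- by rewrite le_max (lambda_max_ge1 R du) orbT.
- by rewrite le_max (lambda_max_ge1 R du).
(* Only the total weight is known to be positive; a restriction of [f] may have weight zero, so each
   summand is bounded by the division-free [energy_le]. *)
rewrite -(ler_pM2r W_gt0) -Ef /energy /weight !edge_sum_one_sum mulrDr.
apply: lerD; apply: le_trans (energy_le _) _;
  apply: ler_wpM2r; rewrite ?le_max ?lexx ?orbT //;
  by rewrite /weight; apply: sumr_ge0 => u _; apply: sumr_ge0 => v _; apply: sqr_ge0.
Qed.
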